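(* Let a magnetic tessellation $(b,\theta,0,1)$ over $X$ with standard edge weights be given, with set of faces $\mathcal{F}$. If $$a=\sup_{F\in\mathcal{F}}\frac{2\,l(\mathcal{C}_F)}{s_\theta(\mathcal{C}_F)}-1<\infty,$$ then the tessellation is $(a,0)_1$-magnetic-sparse.
   Context: Let $X$ be a discrete set. A magnetic graph $(b,\theta,q,m)$ over $X$ consists of: a symmetric function $b:X\times X\to[0,\infty)$ with zero diagonal and $\sum_{y\in X}b(x,y)<\infty$ for all $x$; an antisymmetric function $\theta:X\times X\to\mathbb{R}/2\pi\mathbb{Z}$; a function $q:X\to\mathbb{R}$; and $m:X\to(0,\infty)$. Here $q=0$ and $m=1$. Standard edge weights means $b$ takes values in $\{0,1\}$; $\{x,y\}$ is an edge if $b(x,y)>0$. Magnetic cycle: a magnetic graph $\mathcal{C}=(b,\theta,0,m)$ over a finite set $Y$ is a cycle of length $l(\mathcal{C})=n$ if there is a bijection $\Phi:Y\to\{0,\dots,n-1\}$ such that $b(x,y)>0$ if and only if $(\Phi(x)-\Phi(y)\bmod n)\in\{1,n-1\}$. Put $x_j=\Phi^{-1}(j)$ for $j=0,\dots,n-1$ and $x_n=x_0$. Its magnetic flux is $F_\theta(\mathcal{C})=\sum_{j=0}^{n-1}\theta(x_j,x_{j+1})\bmod 2\pi$, and the strength of the magnetic field is $s_\theta(\mathcal{C})=|1-\exp(iF_\theta(\mathcal{C}))|$. Tessellation: a planar graph such that there exists a set of subgraphs that are cycles such that every edge belongs to exactly two of these cycles (a subgraph is the restriction of the corresponding maps to a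 subset of $X$). These cycles are the faces; $\mathcal{F}$ is the set of faces. For $F\in\mathcal{F}$, $X_F$ is the set of vertices belonging to $F$, $b_F=b\cdot1_{X_F\times X_F}$, $\theta_F=\theta\cdot1_{X_F\times X_F}$, and $\mathcal{C}_F=(b_F,\theta_F,0,1)$ over $X_F$ is a magnetic cycle; $s_\theta(\mathcal{C}_F)$ is the strength of its magnetic field (a quotient with denominator $0$ is read as $+\infty$). Frustration index: for finite $W\subseteq X$ and $\mathbb{T}=\{z\in\mathbb{C}:|z|=1\}$, $\iota_{1,\theta}(W)=\min_{\tau:W\to\mathbb{T}}\frac12\sum_{x,y\in W}b(x,y)|\tau(x)-e^{i\theta(x,y)}\tau(y)|$. With $b(A)=\sum_{(x,y)\in A}b(x,y)$ and $\partial W=(W\times(X\setminus W))\cup((X\setminus W)\times W)$, the magnetic graph $(b,\theta,0,1)$ is $(a,0)_1$-magnetic-sparse if $b(W\times W)\le(1+a)\iota_{1,\theta}(W)+\frac a2b(\partial W)$ for all finite $W\subseteq X$. *)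

(* Defs.v *)
From HB Require Import structures.
From mathcomp Require Import all_boot all_order all_algebra.
From mathcomp Require Import generic_quotient ring_quotient.
From mathcomp Require Import finmap.
From mathcomp Require Import all_classical all_reals all_analysis.
From mathcomp Require Import complex.

Set Implicit Arguments.
Unset Strict Implicit.
Unset Printing Implicit Defensive.

Import Order.TTheory GRing.Theory Num.Theory.
Import numFieldNormedType.Exports.
Import ComplexField.Normc.

Local Open Scope classical_set_scope.
Local Open Scope ring_scope.
Local Open Scope complex_scope.

Definition two_pi_int (R : realType) : {pred R} :=
  fun x => x / (2 * pi) \is a Num.int.

Lemma two_pi_int_zmod_closed (R : realType) : zmod_closed (@two_pi_int R).
Proof.
split=> [|x y]; rewrite -!topredE /= /two_pi_int; first by rewrite mul0r rpred0.
by rewrite mulrBl => xZ yZ; rewrite rpredB.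
Qed.

HB.instance Definition _ (R : realType) :=
  GRing.isZmodClosed.Build R (@two_pi_int R) (@two_pi_int_zmod_closed R).

(* R / 2 pi Z as an additive group. *)
Definition angle (R : realType) : zmodType :=
  Quotient.quot (@two_pi_int R : zmodClosed R).

Definition angle_of (R : realType) (x : R) : angle R :=
  (\pi_(Quotient.quot (@two_pi_int R : zmodClosed R)) x)%qT.

(* exp(i t), independent of the representative by [expi_angle_of]. *)
Definition expi (R : realType) (t : angle R) : R[i] :=
  let x : R := repr t in (cos x +i* sin x).

Lemma expi_angle_of (R : realType) (x : R) :
  expi (angle_of x) = (cos x +i* sin x).
Proof.
rewrite /expi; set y : R := repr _.
have : two_pi_int (x - y).
  suff /eqP : (angle_of x = \pi_(angle R) y)%qT by rewrite -Quotient.idealrBE.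
  by rewrite /y reprK.
rewrite /two_pi_int => /intrP[k xyk].
have pi2 : (2 * pi : R) != 0 by rewrite mulf_neq0// gt_eqF ?pi_gt0.
have {xyk} -> : x = y + (pi *+ 2) *~ k.
  by rewrite -[_ *~ k]mulrzl -xyk -[pi *+ 2]mulr_natl divfK// subrKC.
case: k => n; last rewrite NegzE mulrNz.
  by rewrite pmulrn (periodicn (@cosD2pi R)) (periodicn (@sinD2pi R)).
set z := y - _; have -> : y = z + (pi *+ 2) *+ n.+1 by rewrite subrK.
by rewrite (periodicn (@cosD2pi R)) (periodicn (@sinD2pi R)).
Qed.

Record magnetic_graph (R : realType) (X : choiceType) := MagneticGraph {
  weight : X -> X -> R ;
  theta : X -> X -> angle R ;
  potential : X -> R ;
  mass : X -> R ;
  weight_ge0 : forall x y, 0 <= weight x y ;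
  weightC : forall x y, weight x y = weight y x ;
  weight_diag : forall x, weight x x = 0 ;
  weight_summable :
    forall x, (\esum_(y in [set: X]) (weight x y)%:E < +oo)%E ;
  thetaN : forall x y, theta x y = - theta y x ;
  mass_gt0 : forall x, 0 < mass x }.

Definition standard_weights (R : realType) (X : choiceType)
    (G : magnetic_graph R X) : Prop :=
  forall x y, weight G x y = 0 \/ weight G x y = 1.

Definition edge (R : realType) (X : choiceType) (G : magnetic_graph R X)
  (x y : X) : Prop := 0 < weight G x y.

Section Subgraph.
Variables (R : realType) (X : choiceType) (G : magnetic_graph R X).
Variable F : {fset X}.

Lemma subgraph_summable (x : F) :
  (\esum_(y in [set: F]) (weight G (val x) (val y))%:E < +oo)%E.
Proof.
rewrite esum_fset; [|exact: finite_finset|].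
  by rewrite fsbig_finite; [rewrite lte_sum_pinfty// => y _; rewrite ltry
                           |exact: finite_finset].
by move=> y _; rewrite lee_fin weight_ge0.
Qed.

(* For q = 0 and m = 1 this is the graph C_F, living on F instead of X. *)
Definition subgraph : magnetic_graph R F :=
  @MagneticGraph R F
    (fun x y => weight G (val x) (val y))
    (fun x y => theta G (val x) (val y))
    (fun x => potential G (val x))
    (fun x => mass G (val x))
    (fun x y => weight_ge0 G (val x) (val y))
    (fun x y => weightC G (val x) (val y))
    (fun x => weight_diag G (val x))
    subgraph_summable
    (fun x y => thetaN G (val x) (val y))
    (fun x => mass_gt0 G (val x)).
End Subgraph.

(* [cycle_pos] is the bijection Phi and [cycle_vertex j] is the vertex x_j.
   The labelling is kept as data because the flux depends on it (its sign
   changes with the orientation); the strength does not. *)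
Record cycle_structure (R : realType) (Y : finType) (C : magnetic_graph R Y) :=
  CycleStructure {
    cycle_length : nat ;
    cycle_pos : Y -> 'I_cycle_length ;
    cycle_vertex : 'I_cycle_length -> Y ;
    cycle_posK : cancel cycle_pos cycle_vertex ;
    cycle_vertexK : cancel cycle_vertex cycle_pos ;
    cycle_potential : forall y, potential C y = 0 ;
    cycle_edge : forall x y : Y, edge C x y <->
      (((cycle_pos x)%:Z - (cycle_pos y)%:Z) %% cycle_length)%Z
        \in [:: 1; cycle_length%:Z - 1] }.

Arguments cycle_pos {R Y C} c _.
Arguments cycle_vertex {R Y C} c _.

(* [ordS] is the successor modulo the length, so that x_n = x_0. *)
Definition flux (R : realType) (Y : finType) (C : magnetic_graph R Y)
    (c : cycle_structure C) : angle R :=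
  \sum_(j < cycle_length c)
    theta C (cycle_vertex c j) (cycle_vertex c (ordS j)).

Definition strength (R : realType) (Y : finType) (C : magnetic_graph R Y)
    (c : cycle_structure C) : R :=
  normc (1 - expi (flux c)).

Definition twice_length_over_strength (R : realType) (Y : finType)
    (C : magnetic_graph R Y) (c : cycle_structure C) : \bar R :=
  if strength c == 0 then +oo%E
  else ((2 * (cycle_length c)%:R) / strength c)%:E.

(* The graph can be drawn in the plane R^2: distinct vertices are distinct
   points, an edge is a simple arc between its endpoints (traversed backwards
   when the endpoints are exchanged), and the interior of an edge contains
   neither a vertex nor a point of the interior of another edge. *)
Definition planar (R : realType) (X : choiceType) (G : magnetic_graph R X) :
    Prop :=
  exists (p : X -> R * R) (arc : X -> X -> R -> R * R),
  [/\ injective p,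
      forall x y, edge G x y ->
        [/\ {within `[0, 1], continuous (arc x y)},
            {in `[0, 1] &, injective (arc x y)},
            arc x y 0 = p x & arc x y 1 = p y],
      forall x y, edge G x y ->
        {in `[0, 1], forall t, arc y x t = arc x y (1 - t)},
      forall x y z, edge G x y -> {in `]0, 1[, forall t, arc x y t <> p z} &
      forall x y x' y', edge G x y -> edge G x' y' ->
        (x, y) <> (x', y') -> (x, y) <> (y', x') ->
        {in `]0, 1[ &, forall s t, arc x y s <> arc x' y' t}].

(* A subgraph is determined by its vertex set, so a face is represented by the
   finite set X_F. *)
Record tessellation (R : realType) (X : choiceType) (G : magnetic_graph R X) :=
  Tessellation {
    tessellation_planar : planar G ;
    faces : set {fset X} ;
    face_cycle : forall F, faces F -> cycle_structure (subgraph G F) ;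
    edge_two_faces : forall x y, edge G x y ->
      ([set F | faces F /\ (x \in F) /\ (y \in F)] #= `I_2)%card }.

(* The infimum is over a compact set of functions and is attained. *)
Definition frustration_index (R : realType) (X : choiceType)
    (G : magnetic_graph R X) (W : {fset X}) : R :=
  inf [set 2^-1 * \sum_(x : W) \sum_(y : W) weight G (val x) (val y) *
             normc (tau x - expi (theta G (val x) (val y)) * tau y)
      | tau in [set tau : W -> R[i] | forall x, normc (tau x) = 1]].

Definition total_weight (R : realType) (X : choiceType)
    (G : magnetic_graph R X) (A : set (X * X)) : \bar R :=
  (\esum_(e in A) (weight G e.1 e.2)%:E)%E.

Definition boundary (X : choiceType) (W : {fset X}) : set (X * X) :=
  ([set` W] `*` ~` [set` W]) `|` (~` [set` W] `*` [set` W]).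

(* (a,0)_1-magnetic-sparseness; the definition is for potential 0 and
   mass 1. *)
Definition magnetic_sparse (R : realType) (X : choiceType)
    (G : magnetic_graph R X) (a : R) : Prop :=
  forall W : {fset X},
    (total_weight G ([set` W] `*` [set` W]) <=
       ((1 + a) * frustration_index G W)%:E +
       (a / 2)%:E * total_weight G (boundary W))%E.

(* Main.v *)
Require Import Defs.
From mathcomp Require Import all_boot all_order all_algebra.
From mathcomp Require Import generic_quotient.
From mathcomp Require Import finmap.
From mathcomp Require Import all_classical all_reals all_analysis.
From mathcomp Require Import complex zify ring lra.

(** The reason is local: each edge lies on two faces, so it suffices to compare
    the two sides face by face and add up.

    For a finite set [W] and a gauge [t] with values on the unit circle, write
    [d x y] for [|t x - exp(i theta x y) t y|].  On a face [F] of length [l] and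
    strength [s] with [2 l <= (1 + a) s], the number of edges of [F] inside [W]
    is at most [(1 + a) / 2] times the sum of [d] over these edges plus [a / 2]
    times the number of edges of [F] leaving [W] ([cycle_sparse]):
    - if [W] contains all of [F], transporting [t] once around the face moves it
      by the flux, so the triangle inequality bounds [s] by the sum of [d] over
      the edges of [F] ([strength_le_defect]), and [l <= (1 + a) / 2 * s];
    - if [W] contains some but not all vertices of [F], the cycle leaves [W] and
      comes back, which takes two boundary edges, while at most [l - 1] of its
      edges are inside [W]; since [s <= 2] one has [l - 1 <= a];
    - if [W] misses [F] there is nothing to prove.

    Only finitely many faces have an edge inside [W] ([face_window]).  Summed
    over these, an edge inside [W] is counted exactly twice and every other edge
    at most twice ([gauge_sparse]).  Counting some boundary edges fewer than two
    times is harmless as they occur on the large side, with weight [a >= 0].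
    Taking the infimum over [t] produces the frustration index. *)

Set Implicit Arguments.
Unset Strict Implicit.
Unset Printing Implicit Defensive.

Import Order.TTheory GRing.Theory Num.Theory.
Import ComplexField.Normc.
Local Open Scope classical_set_scope.
Local Open Scope ring_scope.

(** * Phases and parallel transport *)

Section Phase.
Variable R : realType.
Implicit Types s t : angle R.

Lemma angle_ofK t : angle_of (repr t) = t.
Proof. exact: reprK. Qed.

Lemma angle_ofD (x y : R) : angle_of (x + y) = angle_of x + angle_of y.
Proof. exact: (raddfD (\pi_(angle R))%qT). Qed.

Lemma expi0 : expi (0 : angle R) = 1.
Proof.
have -> : (0 : angle R) = angle_of 0.
  by symmetry; exact: (raddf0 (\pi_(angle R))%qT).
by rewrite expi_angle_of cos0 sin0.
Qed.

Lemma expiD s t : expi (s + t) = expi s * expi t.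
Proof.
rewrite -[in LHS](angle_ofK s) -[in LHS](angle_ofK t) -angle_ofD.
rewrite -{2}(angle_ofK s) -{2}(angle_ofK t) !expi_angle_of cosD sinD.
by apply/eqP; rewrite eq_complex /= addrC eqxx /= addrC eqxx.
Qed.

Lemma normc_expi t : normc (expi t) = 1.
Proof. by rewrite -(angle_ofK t) expi_angle_of /= cos2Dsin2 sqrtr1. Qed.

Lemma normc_ge0 (z : R[i]%C) : 0 <= normc z.
Proof. by case: z => x y; exact: sqrtr_ge0. Qed.

(** Rotating by [expi t] preserves the modulus; this makes the defect of an edge
    independent of its orientation. *)
Lemma normc_sub_expi_sym t (x y : R[i]%C) :
  normc (x - expi (- t) * y) = normc (y - expi t * x).
Proof.
rewrite -[RHS]normcN opprB -[LHS]mul1r -(normc_expi t) -normcM mulrBr mulrA.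
by rewrite -expiD subrr expi0 mul1r.
Qed.

(** Transporting along a path accumulates the phases, so the defect between the
    end points is controlled by the defects of the steps. *)
Lemma normc_gauge_chain (z : nat -> R[i]%C) (th : nat -> angle R) k :
  normc (z 0%N - expi (\sum_(j < k) th j) * z k) <=
  \sum_(j < k) normc (z j - expi (th j) * z j.+1).
Proof.
elim: k => [|k IH]; first by rewrite !big_ord0 expi0 mul1r subrr normc0.
rewrite !big_ord_recr/= expiD.
set A := expi (\sum_(_ < _) _) in IH *.
have -> : z 0%N - A * expi (th k) * z k.+1 =
    (z 0%N - A * z k) + A * (z k - expi (th k) * z k.+1) by ring.
rewrite (le_trans (le_normcD _ _))// lerD// normcM normc_expi mul1r//.
Qed.
End Phase.

(** * The cyclic successor on ordinals *)

Section CyclicIndex.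
Variable n : nat.
Implicit Type i j : 'I_n.

Lemma val_iter_ordS k i : val (iter k (@ordS n) i) = ((i + k) %% n)%N.
Proof.
elim: k => [|k IH]; first by rewrite addn0 modn_small.
by rewrite /= IH -addn1 modnDml addn1 addnS.
Qed.

Lemma iter_ordS_reach i j : exists k, iter k (@ordS n) i = j.
Proof.
exists (j + (n - i))%N; apply: val_inj; rewrite val_iter_ordS.
have -> : (i + (j + (n - i)) = j + n)%N by have := ltn_ord i; lia.
by rewrite modnDr modn_small.
Qed.

(** A set of residues closed under the successor is empty or everything, since
    the successor acts transitively. *)
Lemma ordS_exit (P : pred 'I_n) i j :
  P i -> ~~ P j -> exists k, P k && ~~ P (ordS k).
Proof.
move=> Pi nPj; apply: contrapT => /forallNP noexit.
have [k kj] := iter_ordS_reach i j.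
move: nPj; rewrite -kj; apply/negP/negPn => {kj j}.
elim: k => //= k IH; move: (noexit (iter k (@ordS n) i)).
by rewrite IH/= => /negP; rewrite negbK.
Qed.

Lemma ordS_neq_ord_pred j : (2 < n)%N -> ordS j != ord_pred j.
Proof.
move=> n_gt2; apply/eqP => e; have : (j.+2 %% n = j)%N.
  rewrite -[in RHS](ord_predK j) -e /= -[(j.+1 %% n).+1]addn1 modnDml.
  by rewrite addn1.
have hj := ltn_ord j; case: (ltnP j.+2 n) => h.
  by rewrite modn_small// => ?; lia.
rewrite (_ : j.+2 = j.+2 - n + n)%N; last lia.
rewrite modnDr modn_small; lia.
Qed.

(** Translates adjacency as differences modulo [n] into the successor and
    predecessor maps, which are bijections along which sums can be reindexed. *)
Lemma cyclic_adjacentE i j :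
  (((i%:Z - j%:Z) %% n)%Z \in [:: 1; n%:Z - 1]) =
  (j == ordS i) || (j == ord_pred i).
Proof.
have := ltn_ord i; have := ltn_ord j => hj hi.
have jS : (j == i.+1 %% n :> nat)%N =
          (j == i.+1 :> nat) || ((j == 0 :> nat) && (i.+1 == n :> nat)).
  case: (ltnP i.+1 n) => h; first by rewrite modn_small//; lia.
  by rewrite (_ : i.+1 = n)%N ?modnn; lia.
have jP : (j == (i + n).-1 %% n :> nat)%N =
          (j.+1 == i :> nat) || ((i == 0 :> nat) && (j.+1 == n :> nat)).
  case: (posnP i) => h; first by rewrite h modn_small; lia.
  rewrite (_ : (i + n).-1 = i.-1 + n)%N; last lia.
  by rewrite modnDr modn_small; lia.
rewrite -!(inj_eq val_inj)/= {}jS {}jP !inE.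
case: (leqP j i) => h.
  by rewrite modz_small; lia.
have -> : ((i%:Z - j%:Z) %% n)%Z = i%:Z - j%:Z + n%:Z.
  by rewrite -[LHS]modzDr modz_small; lia.
lia.
Qed.
End CyclicIndex.

Definition gauge_defect (R : realType) (X : choiceType)
    (G : magnetic_graph R X) (t : X -> R[i]%C) (x y : X) : R :=
  normc (t x - expi (theta G x y) * t y).

(** * A single magnetic cycle *)

Section Cycle.
Variables (R : realType) (Y : finType) (C : magnetic_graph R Y).
Variable c : cycle_structure C.
Let n := cycle_length c.
Let v := @cycle_vertex R Y C c.

Lemma strength_le2 : strength c <= 2.
Proof.
rewrite /strength (le_trans (le_normcD _ _))// normcN normc_expi normc1; lra.
Qed.

(** A cycle of length at most two is degenerate: it is empty, needs a loop, or
    runs through its only edge back and forth. *)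
Lemma flux_short : (n <= 2)%N -> flux c = 0.
Proof.
rewrite /flux {}/n {}/v; case: c => -[|[|[|//]]] pos vtx /= posK vtxK ? edg _.
- by rewrite big_ord0.
- have : edge C (vtx ord0) (vtx ord0).
    by apply/edg; rewrite subrr mod0z.
  by rewrite /edge weight_diag ltxx.
- rewrite !big_ord_recl big_ord0 addr0.
  have -> : ordS (ord0 : 'I_2) = lift ord0 ord0 by apply: val_inj.
  have -> : ordS (lift ord0 ord0 : 'I_2) = ord0 by apply: val_inj.
  by rewrite thetaN addNr.
Qed.

Lemma strength_neq0_length : strength c != 0 -> (2 < n)%N.
Proof.
rewrite ltnNge; apply: contra => /flux_short; rewrite /strength => ->.
by rewrite expi0 subrr normc0.
Qed.

Hypothesis std : standard_weights C.
Hypothesis n_gt2 : (2 < n)%N.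

Lemma cycle_weight (j k : 'I_n) :
  weight C (v j) (v k) = ((k == ordS j) || (k == ord_pred j))%:R.
Proof.
have edgeE : edge C (v j) (v k) <-> (k == ordS j) || (k == ord_pred j).
  by rewrite (cycle_edge c) !cycle_vertexK cyclic_adjacentE.
case: (boolP (_ || _)) => [/edgeE|/negP nadj].
  by rewrite /edge; case: (std (v j) (v k)) => -> //; rewrite ltxx.
case: (std (v j) (v k)) => // e; case: nadj; apply/edgeE.
by rewrite /edge e ltr01.
Qed.

(** Three vertices or more are needed for the two neighbours of a vertex to
    be distinct, so that every edge appears once in each direction. *)
Lemma cycle_sum (f : Y -> Y -> R) :
  \sum_x \sum_y weight C x y * f x y =
  \sum_(j < n) (f (v j) (v (ordS j)) + f (v (ordS j)) (v j)).
Proof.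
have vbij : bijective v.
  by exists (cycle_pos c); [exact: cycle_vertexK|exact: cycle_posK].
rewrite (reindex v)/=; last exact: onW_bij.
under eq_bigr => j _.
  rewrite (reindex v)/=; last exact: onW_bij.
  rewrite (bigD1 (ordS j))//= (bigD1 (ord_pred j))/=; last first.
    by rewrite eq_sym ordS_neq_ord_pred.
  rewrite big1 => [|k /andP[/negPf kS /negPf kP]]; last first.
    by rewrite cycle_weight kS kP mul0r.
  rewrite !cycle_weight !eqxx orbT !mul1r addr0.
  over.
rewrite !big_split/=; congr (_ + _).
rewrite [LHS](reindex (@ordS n))/=; last exact/onW_bij/ordS_bij.
by under eq_bigr do rewrite ordSK.
Qed.

(** Closing up the chain inequality around the cycle: [t] returns to its initial
    value, multiplied by the phase of the flux. *)
Lemma strength_le_defect (t : Y -> R[i]%C) : (forall y, normc (t y) = 1) ->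
  strength c <= \sum_(j < n) gauge_defect C t (v j) (v (ordS j)).
Proof.
move=> t1; have n_gt0 : (0 < n)%N by exact: leq_trans n_gt2.
(* The vertices [x_0, ..., x_n = x_0] as a sequence indexed by [nat]. *)
pose u k := v (Ordinal (ltn_pmod k n_gt0)).
have uE (j : 'I_n) : u j = v j.
  by congr v; apply: val_inj; rewrite /= modn_small.
have uS (j : 'I_n) : u j.+1 = v (ordS j) by congr v; apply: val_inj.
have un : u n = u 0%N by congr v; apply: val_inj; rewrite /= modnn mod0n.
have -> : strength c = normc (t (u 0%N) - expi (flux c) * t (u n)).
  by rewrite un -[X in X - _]mul1r -mulrBl normcM t1 mulr1.
have -> : flux c = \sum_(j < n) theta C (u j) (u j.+1).
  by apply: eq_bigr => j _; rewrite uE uS.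
pose th k := theta C (u k) (u k.+1).
apply: le_trans (normc_gauge_chain (t \o u) th n) _.
by apply: ler_sum => j _; rewrite /= /th uE uS.
Qed.

Lemma gauge_defectC t x y : gauge_defect C t x y = gauge_defect C t y x.
Proof. by rewrite /gauge_defect thetaN normc_sub_expi_sym. Qed.

Lemma sum_exit_ge1 (P : pred 'I_n) i j : P i -> ~~ P j ->
  1 <= \sum_(k < n) (P k && ~~ P (ordS k))%:R :> R.
Proof.
move=> Pi /(ordS_exit Pi)[k exitk].
by rewrite (bigD1 k)//= exitk lerDl sumr_ge0.
Qed.

(** The sums run over ordered pairs: the first and second count each edge twice,
    while the third counts a boundary edge once, directed outwards.  This is why
    its coefficient is [a] and not [a / 2]. *)
Lemma cycle_sparse (a : R) (w : pred Y) (t : Y -> R[i]%C) :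
  0 <= a -> 2 * n%:R <= (1 + a) * strength c ->
  (forall y, normc (t y) = 1) ->
  \sum_x \sum_y weight C x y * (w x && w y)%:R <=
  (1 + a) / 2 *
    (\sum_x \sum_y weight C x y * ((w x && w y)%:R * gauge_defect C t x y)) +
  a * (\sum_x \sum_y weight C x y * (w x && ~~ w y)%:R).
Proof.
move=> a0 an t1; rewrite !cycle_sum.
have defect_ge0 x y : 0 <= gauge_defect C t x y by exact: normc_ge0.
have n_le : n%:R <= 1 + a.
  by have := strength_le2; nra.
set E := (X in _ <= _ * X + _).
set D := (X in _ <= _ + _ * X).
have E0 : 0 <= E.
  by apply: sumr_ge0 => j _; rewrite addr_ge0// mulr_ge0.
have D0 : 0 <= D by apply: sumr_ge0 => j _; rewrite addr_ge0.
(* If the whole cycle lies in [w], the defects alone pay for its length. *)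
have [allw|/existsP/= [j wj]] := boolP [forall j, w (v j)].
  have w1 j : w (v j) by exact: (forallP allw).
  have -> : E = 2 * \sum_(j < n) gauge_defect C t (v j) (v (ordS j)).
    rewrite mulr_sumr; apply: eq_bigr => j _.
    by rewrite !w1 !mul1r [in X in _ + X]gauge_defectC; ring.
  under eq_bigr do rewrite !w1/=.
  rewrite sumr_const card_ord -mulr_natr.
  have := strength_le_defect t1; nra.
have [/existsP[i wi]|/existsPn/= now] := boolP [exists i, w (v i)]; last first.
  rewrite big1 => [|k _]; first by rewrite addr_ge0// mulr_ge0//; lra.
  by rewrite !(negPf (now _)) addr0.
(* The cycle meets both [w] and its complement. *)
have exit1 := @sum_exit_ge1 (fun k => w (v k)) _ _ wi wj.
(* Entering [w] is leaving its complement. *)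
have entry1 : 1 <= \sum_(k < n) (w (v (ordS k)) && ~~ w (v k))%:R :> R.
  have := @sum_exit_ge1 (fun k => ~~ w (v k)) j i wj; rewrite negbK => /(_ wi).
  by under eq_bigr do rewrite negbK andbC.
have D2 : 2 <= D by rewrite /D big_split/=; lra.
have : \sum_(k < n) ((w (v k) && w (v (ordS k)))%:R +
                    (w (v (ordS k)) && w (v k))%:R) <=
   \sum_(k < n) 2 - 2 * \sum_(k < n) (w (v k) && ~~ w (v (ordS k)))%:R :> R.
  rewrite mulr_sumr -sumrB; apply: ler_sum => k _.
  by case: (w _); case: (w _) => /=; lra.
rewrite sumr_const card_ord -[2 *+ _]mulr_natr; nra.
Qed.
End Cycle.

(** * Weighted sums over pairs of vertices *)

Section PairSum.
Variables (R : realType) (X : choiceType) (G : magnetic_graph R X).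

Definition pair_sum (s : {fset X}) (f : X -> X -> R) : R :=
  \sum_(x <- s) \sum_(y <- s) weight G x y * f x y.

(** Sums over different vertex sets are brought to a common one, so that they
    can be added termwise. *)
Lemma pair_sum_sub (F N : {fset X}) f : (F `<=` N)%fset ->
  pair_sum F f = pair_sum N (fun x y => ((x \in F) && (y \in F))%:R * f x y).
Proof.
move=> FN; have sumE (h : X -> R) :
    \sum_(x <- F) h x = \sum_(x <- N) (x \in F)%:R * h x.
  rewrite -(big_fset_incl _ FN) => [|x _ /negPf ->]; last by rewrite mul0r.
  by apply: eq_big_seq => x ->; rewrite mul1r.
rewrite /pair_sum sumE; apply: eq_bigr => x _; rewrite sumE mulr_sumr.
by apply: eq_bigr => y _; rewrite -mulnb natrM; ring.
Qed.

Lemma pair_sumC s f : pair_sum s f = pair_sum s (fun x y => f y x).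
Proof.
rewrite /pair_sum exchange_big/=; apply: eq_bigr => x _; apply: eq_bigr => y _.
by rewrite weightC.
Qed.

Lemma pair_sumD s f g :
  pair_sum s (fun x y => f x y + g x y) = pair_sum s f + pair_sum s g.
Proof.
rewrite /pair_sum -big_split/=; apply: eq_bigr => x _; rewrite -big_split/=.
by apply: eq_bigr => y _; rewrite mulrDr.
Qed.

Lemma pair_sumZ s k f :
  pair_sum s (fun x y => k * f x y) = k * pair_sum s f.
Proof.
rewrite /pair_sum mulr_sumr; apply: eq_bigr => x _; rewrite mulr_sumr.
by apply: eq_bigr => y _; rewrite mulrCA.
Qed.

Lemma pair_sum_sum (I : Type) (r : seq I) s (f : I -> X -> X -> R) :
  \sum_(i <- r) pair_sum s (f i) =
  pair_sum s (fun x y => \sum_(i <- r) f i x y).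
Proof.
rewrite /pair_sum exchange_big/=; apply: eq_bigr => x _.
by rewrite exchange_big/=; apply: eq_bigr => y _; rewrite mulr_sumr.
Qed.

Lemma ler_pair_sum s f g : (forall x y, edge G x y -> f x y <= g x y) ->
  pair_sum s f <= pair_sum s g.
Proof.
move=> fg; apply: ler_sum => x _; apply: ler_sum => y _.
have := weight_ge0 G x y; rewrite le_eqVlt => /predU1P[<-|xy].
  by rewrite !mul0r.
by rewrite ler_pM2l//; exact: fg.
Qed.

Lemma total_weight_window (N : {fset X}) (P : X -> X -> bool) :
  total_weight G [set e | [/\ e.1 \in N, e.2 \in N & P e.1 e.2]] =
  (pair_sum N (fun x y => (P x y)%:R))%:E.
Proof.
pose r := [seq e <- [seq (x, y) | x <- enum_fset N, y <- enum_fset N] |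
              P e.1 e.2].
have -> : [set e | [/\ e.1 \in N, e.2 \in N & P e.1 e.2]] = [set` r].
  apply/seteqP; split=> -[x y] /=; rewrite mem_filter.
    by case=> xN yN Pxy; rewrite Pxy/=; apply/allpairsP; exists (x, y).
  case/andP=> Pxy /allpairsP[[x' y'] /= [xN yN [ex ey]]].
  by rewrite ex ey in Pxy *.
have r_uniq : uniq r.
  by rewrite filter_uniq// allpairs_uniq// => -[? ?] [? ?] _ _ [-> ->].
have r_fin : finite_set [set` r] by exact: finite_seq.
rewrite /total_weight esum_fset//; last first.
  by move=> e _; rewrite lee_fin weight_ge0.
rewrite -fsbig_seq// big_filter big_mkcond big_allpairs/= -sumEFin.
apply: eq_bigr => x _; rewrite -sumEFin; apply: eq_bigr => y _.
by case: (P x y); rewrite ?mulr1 ?mulr0.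
Qed.

Lemma total_weight_subset (A B : set (X * X)) : A `<=` B ->
  (total_weight G A <= total_weight G B)%E.
Proof.
move=> AB; apply: le_ereal_sup; apply: image_subset => F -[finF FA].
by split=> //; exact: subset_trans FA AB.
Qed.
End PairSum.

(** * Faces of a tessellation *)

Section Tess.
Variables (R : realType) (X : choiceType) (G : magnetic_graph R X).
Variables (T : tessellation G).
Variables (std : standard_weights G).

Lemma face_sparse (a : R) (F : {fset X}) (FT : faces T F)
    (w : pred X) (t : X -> R[i]%C) :
  let c := face_cycle FT in
  0 <= a -> strength c != 0 ->
  2 * (cycle_length c)%:R <= (1 + a) * strength c ->
  (forall y, normc (t y) = 1) ->
  pair_sum G F (fun x y => (w x && w y)%:R) <=
  (1 + a) / 2 *
    pair_sum G F (fun x y => (w x && w y)%:R * gauge_defect G t x y) +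
  a * pair_sum G F (fun x y => (w x && ~~ w y)%:R).
Proof.
move=> c a0 s0 sa t1.
have pair_sumE f : pair_sum G F f =
    \sum_x \sum_y weight (subgraph G F) x y * f (val x) (val y).
  rewrite /pair_sum big_seq_fsetE; apply: eq_bigr => x _.
  by rewrite big_seq_fsetE.
rewrite !pair_sumE.
apply: (@cycle_sparse _ _ _ c _ _ _ (w \o val) (t \o val)) => //.
- by move=> x y; exact: std.
- exact: strength_neq0_length.
- by move=> y; exact: t1.
Qed.

Let faces_of (x y : X) := [set F | faces T F /\ (x \in F) /\ (y \in F)].

Lemma finite_faces_of x y : edge G x y -> finite_set (faces_of x y).
Proof. by move=> xy; apply/finite_setP; exists 2%N; exact: edge_two_faces. Qed.

(** [Phi] collects the faces that have an edge inside [W], and [N] is large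
    enough for all of them.  Restricting to the finite window [N]
    keeps every sum finite. *)
Lemma face_window (W : {fset X}) :
  exists (Phi : {fset {fset X}}) (N : {fset X}),
  [/\ (W `<=` N)%fset,
      forall F, F \in Phi -> faces T F /\ (F `<=` N)%fset,
      forall x y, edge G x y ->
        (\sum_(F <- Phi) ((x \in F) && (y \in F))%:R <= 2 :> R) &
      forall x y, edge G x y -> x \in W -> y \in W ->
        \sum_(F <- Phi) ((x \in F) && (y \in F))%:R = 2 :> R].
Proof.
pose D := [set e : X * X | [/\ e.1 \in W, e.2 \in W & edge G e.1 e.2]].
pose S := \bigcup_(e in D) faces_of e.1 e.2.
have finS : finite_set S.
  apply: bigcup_finite => [|[x y] [_ _]]; last exact: finite_faces_of.
  apply: (@sub_finite_set _ _ [set` (W `*` W)%fset]) => //.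
  by move=> [x y] /= [xW yW _]; rewrite in_fsetM xW.
pose Phi := fset_set S.
have PhiE F : (F \in Phi) = (F \in S) by rewrite in_fset_set.
have countE x y : \sum_(F <- Phi) ((x \in F) && (y \in F))%:R =
    (size [seq F <- enum_fset Phi | (x \in F) && (y \in F)])%:R :> R.
  rewrite size_filter -sum1_count natr_sum [RHS]big_mkcond.
  by apply: eq_bigr => F _; case: (_ && _).
have sz x y : edge G x y -> size (enum_fset (fset_set (faces_of x y))) = 2%N.
  by move=> xy; apply: card_fset_set; exact: edge_two_faces.
exists Phi, (W `|` \bigcup_(F <- Phi) F)%fset; split.
- exact: fsubsetUl.
- move=> F FPhi; split; last first.
    apply: fsubset_trans (fsubsetUr _ _).
    exact: (@bigfcup_sup _ _ _ F xpredT id).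
  by move: FPhi; rewrite PhiE inE => -[e _] [].
- move=> x y xy; rewrite countE ler_nat -(sz _ _ xy).
  apply: uniq_leq_size => [|F]; first by rewrite filter_uniq.
  rewrite mem_filter => /andP[/andP[xF yF] FPhi].
  have : F \in S by rewrite -PhiE.
  rewrite inE => -[e _] [FT _].
  have : F \in fset_set (faces_of x y); last by [].
  by rewrite in_fset_set ?inE//; exact: finite_faces_of.
- move=> x y xy xW yW; rewrite countE -(sz _ _ xy); congr (_%:R).
  apply: (@perm_size {fset X}).
  apply: uniq_perm; rewrite ?filter_uniq ?fset_uniq// => F.
  have FPhiE : (F \in enum_fset Phi) = (F \in S) := PhiE F.
  have FxyE : (F \in enum_fset (fset_set (faces_of x y))) =
              (F \in faces_of x y).
    exact: (in_fset_set (finite_faces_of xy)).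
  rewrite mem_filter {}FPhiE {}FxyE.
  apply/andP/idP; rewrite !inE.
    by move=> [/andP[xF yF] [e _] []].
  by move=> [FT [xF yF]]; rewrite xF yF; split=> //; exists (x, y).
Qed.
End Tess.

(** * Sparseness *)

Section Sparse.
Variables (R : realType) (X : choiceType) (G : magnetic_graph R X).
Variables (std : standard_weights G) (T : tessellation G).
Variable a : R.
Hypothesis a_ge0 : 0 <= a.
Hypothesis strong : forall F (FT : faces T F), strength (face_cycle FT) != 0 /\
  2 * (cycle_length (face_cycle FT))%:R <= (1 + a) * strength (face_cycle FT).

(** The sum over [Phi] of the inequalities of [face_sparse].  The window [N]
    is chosen before the gauge [t], so that the boundary term is a constant when
    the infimum over [t] is taken. *)
Lemma gauge_sparse (W : {fset X}) : exists2 N : {fset X}, (W `<=` N)%fset &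
  forall t : X -> R[i]%C, (forall x, normc (t x) = 1) ->
  pair_sum G W (fun _ _ => 1) <=
  (1 + a) / 2 * pair_sum G W (gauge_defect G t) +
  a * pair_sum G N (fun x y => ((x \in W) && (y \notin W))%:R).
Proof.
have [Phi [N [WN PhiN le2 eq2]]] := face_window T W.
exists N => // t t1.
pose inner x y : R := ((x \in W) && (y \in W))%:R.
pose exit x y : R := ((x \in W) && (y \notin W))%:R.
pose g x y := (1 + a) / 2 * (inner x y * gauge_defect G t x y) +
              a * exit x y + -1 * inner x y.
have gE s : pair_sum G s g = (1 + a) / 2 *
    pair_sum G s (fun x y => inner x y * gauge_defect G t x y) +
    a * pair_sum G s exit - pair_sum G s inner.
  by rewrite !pair_sumD !pair_sumZ mulN1r.
have g_face F : F \in Phi -> 0 <= pair_sum G F g.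
  move=> /PhiN[FT _]; have [s0 sa] := strong FT.
  rewrite gE subr_ge0.
  exact: (@face_sparse _ _ G T std a F FT (fun x => x \in W) t).
(* Inside [W] the multiplicity is exactly 2; elsewhere [g] is nonnegative and an
   upper bound on the multiplicity suffices. *)
have : 0 <= 2 * pair_sum G N g.
  apply: (@le_trans _ _ (\sum_(F <- Phi) pair_sum G F g)).
    by rewrite big_seq; apply: sumr_ge0 => F; exact: g_face.
  rewrite big_seq (eq_bigr _ (fun F FPhi => pair_sum_sub _ _ (PhiN F FPhi).2)).
  rewrite -big_seq pair_sum_sum -pair_sumZ; apply: ler_pair_sum => x y xy.
  rewrite -mulr_suml; have [/andP[xW yW]|nWW] := boolP ((x \in W) && (y \in W)).
    by rewrite eq2.
  rewrite ler_wpM2r ?le2// /g /inner (negPf nWW) mul0r !mulr0 add0r addr0.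
  by rewrite mulr_ge0.
rewrite pmulr_rge0// gE subr_ge0.
rewrite [pair_sum G W (fun _ _ => 1)](pair_sum_sub _ _ WN).
rewrite [pair_sum G W _](pair_sum_sub _ _ WN).
have -> // : pair_sum G N inner =
  pair_sum G N (fun x y => ((x \in W) && (y \in W))%:R * 1).
by apply: eq_bigr => x _; apply: eq_bigr => y _; rewrite mulr1.
Qed.

(** Gauges on [W] extend to all vertices by [1], so gauges defined on the whole
    graph suffice to bound the infimum. *)
Lemma frustration_ge (W : {fset X}) (r : R) :
  (forall t : X -> R[i]%C, (forall x, normc (t x) = 1) ->
     r <= 2^-1 * pair_sum G W (gauge_defect G t)) ->
  r <= frustration_index G W.
Proof.
move=> rt; apply: lb_le_inf.
  by eexists; exists (fun=> 1) => //= x; exact: normc1.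
move=> _ [tau /= tau1 <-].
pose t x := if insub x is Some u then tau u else 1.
have tE (u : W) : t (val u) = tau u by rewrite /t valK.
have -> : \sum_(x : W) \sum_(y : W) weight G (val x) (val y) *
    normc (tau x - expi (theta G (val x) (val y)) * tau y) =
    pair_sum G W (gauge_defect G t).
  rewrite /pair_sum big_seq_fsetE; apply: eq_bigr => x _.
  by rewrite big_seq_fsetE; apply: eq_bigr => y _; rewrite /gauge_defect !tE.
by apply: rt => x; rewrite /t; case: insub => [u|]; [exact: tau1|exact: normc1].
Qed.

(** [total_weight] counts a boundary edge in both directions and [gauge_sparse]
    only outwards, which turns the coefficient [a] into [a / 2]. *)
Lemma strong_faces_sparse : magnetic_sparse G a.
Proof.
move=> W; have [N WN key] := gauge_sparse W.
set e := pair_sum G N _ in key.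
have WW : total_weight G ([set` W] `*` [set` W]) =
    (pair_sum G W (fun _ _ => 1))%:E.
  rewrite -(total_weight_window G W (fun _ _ => true)); congr total_weight.
  by apply/seteqP; split=> -[x y] /= [].
have bW : ((2 * e)%:E <= total_weight G (boundary W))%E.
  have -> : 2 * e = pair_sum G N (fun x y => ((x \in W) != (y \in W))%:R).
    rewrite mulr_natl mulr2n {2}/e pair_sumC -pair_sumD.
    apply: eq_bigr => x _; apply: eq_bigr => y _; congr (_ * _).
    by case: (x \in W); case: (y \in W); rewrite /= ?addr0 ?add0r.
  rewrite -total_weight_window; apply: total_weight_subset => -[x y] /= [_ _].
  rewrite /boundary/=.
  case: (boolP (x \in W)); case: (boolP (y \in W)) => //= /negP ? ? _.
    by left.
  by right.
have a1 : 0 < 1 + a by rewrite ltr_wpDr.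
have fr : (pair_sum G W (fun _ _ => 1) - a * e) / (1 + a) <=
    frustration_index G W.
  apply: frustration_ge => t /key h; rewrite ler_pdivrMr//.
  by move: h; lra.
rewrite WW; apply: (@le_trans _ _
    (((1 + a) * frustration_index G W)%:E + (a / 2)%:E * (2 * e)%:E)%E).
  rewrite -EFinM -EFinD lee_fin; move: fr; rewrite ler_pdivrMr//.
  by lra.
rewrite leeD2l// lee_wpmul2l// lee_fin divr_ge0//.
Qed.
End Sparse.

Theorem corollary4p11 (R : realType) (X : choiceType) (G : magnetic_graph R X)
  (q0 : forall x, potential G x = 0) (m1 : forall x, mass G x = 1)
  (std : standard_weights G) (T : tessellation G) (a : \bar R)
  (a_def : a = (ereal_sup
     [set r | exists (F : {fset X}) (FT : faces T F),
        r = twice_length_over_strength (face_cycle FT)] - 1)%E)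
  (a_fin : (a < +oo)%E) :
  magnetic_sparse G (fine a).
Proof.
pose ratio := [set r | exists (F : {fset X}) (FT : faces T F),
        r = twice_length_over_strength (face_cycle FT)].
have sup_fin : (ereal_sup ratio < +oo)%E.
  move: a_fin; rewrite a_def -/ratio.
  by case: (ereal_sup ratio) => [s _|//|_]; rewrite ?ltry.
have strength0 F (FT : faces T F) : strength (face_cycle FT) != 0.
  apply/negP => s0; move: sup_fin; rewrite ltNge => /negP; apply.
  apply: ereal_sup_ubound; exists F, FT.
  by rewrite /twice_length_over_strength s0.
have ratio_le F (FT : faces T F) :
    2 * (cycle_length (face_cycle FT))%:R / strength (face_cycle FT)
      <= 1 + fine a.
  have : (twice_length_over_strength (face_cycle FT) <= ereal_sup ratio)%E.
    by apply: ereal_sup_ubound; exists F, FT.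
  rewrite a_def -/ratio /twice_length_over_strength (negPf (strength0 _ _)).
  by case: (ereal_sup ratio) sup_fin => [s| |] //= _; rewrite lee_fin; lra.
have strength_gt0 F (FT : faces T F) : 0 < strength (face_cycle FT).
  by rewrite lt_def strength0 normc_ge0.
apply: (strong_faces_sparse std (T := T)); last first.
  move=> F FT; split; first exact: strength0.
  by rewrite -ler_pdivrMr//; exact: ratio_le.
(* Without faces the supremum is [-oo], and [fine] sends it to 0. *)
have [r0|/set0P[_ [F [FT _]]]] := eqVneq ratio set0.
  by rewrite a_def -/ratio r0 ereal_sup0.
(* A face has length at least 3 and strength at most 2. *)
have le := ratio_le F FT; have s2 := strength_le2 (face_cycle FT).
have s_gt0 := strength_gt0 F FT.
have n3 : 3 <= (cycle_length (face_cycle FT))%:R :> R.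
  by rewrite ler_nat; exact: strength_neq0_length (strength0 F FT).
move: le; rewrite ler_pdivrMr//; nra.
Qed.
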